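(* Let $\{X_\gamma\}_{\gamma\in\Gamma}$ be a family of strictly convex real Banach spaces such that $|\Gamma|\geq 2$ and such that, for every $\gamma\in\Gamma$, $\dim(X_\gamma)\geq 2$ and the set $Sm(X_\gamma)$ of smooth points of $X_\gamma$ is norm dense in the unit sphere $S_{X_\gamma}$. Then both $Z_0=\bigoplus^{c_0}_{\gamma\in\Gamma}X_\gamma$ and $Z_\infty=\bigoplus^{\ell_\infty}_{\gamma\in\Gamma}X_\gamma$ satisfy the Mazur--Ulam property.
   Context: All Banach spaces are real. $Z_\infty=\bigoplus^{\ell_\infty}_{\gamma\in\Gamma}X_\gamma$ is the space of all families $z=(z(\gamma))_{\gamma\in\Gamma}$ with $z(\gamma)\in X_\gamma$ and $\|z\|=\sup_\gamma\|z(\gamma)\|<\infty$; $Z_0=\bigoplus^{c_0}_{\gamma\in\Gamma}X_\gamma$ is the closed subspace of those $z$ such that $\{\gamma:\|z(\gamma)\|>\varepsilon\}$ is finite for every $\varepsilon>0$. A Banach space is strictly convex if every point of its unit sphere is an extreme point of its closed unit ball. A point $x\in S_X$ is a smooth point if there is a unique $f\in S_{X^*}$ with $f(x)=1$. A Banach space $Z$ satisfies the Mazur--Ulam property if for every Banach space $Y$, every surjective isometry $\Delta:S_Z\to S_Y$ between the unit spheres admits an extension to a surjective real-linear isometry from $Z$ onto $Y$. *)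

(* Defs.v *)
From HB Require Import structures.
From mathcomp Require Import all_boot all_order all_algebra.
From mathcomp Require Import all_classical all_reals all_analysis.
Set Implicit Arguments. Unset Strict Implicit. Unset Printing Implicit Defensive.
Import Order.TTheory GRing.Theory Num.Theory.
Import numFieldNormedType.Exports.
Local Open Scope classical_set_scope.
Local Open Scope ring_scope.

Section Defs.
Variable R : realType.

Section Single.
Variable V : normedModType R.

Definition unit_ball : set V := [set x | `|x| <= 1].
Definition unit_sphere : set V := [set x | `|x| = 1].

Definition extreme_point (C : set V) (x : V) : Prop :=
  C x /\ forall (y z : V) (t : R), C y -> C z -> 0 < t < 1 ->
    x = t *: y + (1 - t) *: z -> y = x /\ z = x.

Definition strictly_convex : Prop :=
  forall x, unit_sphere x -> extreme_point unit_ball x.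

Definition dim_ge2 : Prop :=
  exists x y : V, forall a b : R, a *: x + b *: y = 0 -> a = 0 /\ b = 0.

Definition linear_functional (f : V -> R) : Prop :=
  forall (a : R) (u v : V), f (a *: u + v) = a * f u + f v.

Definition dual_sphere (f : V -> R) : Prop :=
  linear_functional f /\
  (forall y, `|f y| <= `|y|) /\
  (forall e : R, 0 < e -> exists y, `|y| <= 1 /\ 1 - e < `|f y|).

Definition smooth_point (x : V) : Prop :=
  unit_sphere x /\
  (exists f, dual_sphere f /\ f x = 1) /\
  (forall f g, dual_sphere f -> f x = 1 -> dual_sphere g -> g x = 1 -> f = g).

Definition smooth_dense_in_sphere : Prop :=
  forall x, unit_sphere x -> forall e : R, 0 < e ->
    exists y, smooth_point y /\ `|x - y| < e.

End Single.

Section Sums.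
Variables (G : Type) (X : G -> completeNormedModType R).

Definition fam := forall g : G, X g.
Definition fam_add (z w : fam) : fam := fun g => z g + w g.
Definition fam_scale (a : R) (z : fam) : fam := fun g => a *: z g.
Definition fam_sub (z w : fam) : fam := fun g => z g - w g.

Definition in_linf (z : fam) : Prop := exists M : R, forall g, `|z g| <= M.

Definition in_c0 (z : fam) : Prop :=
  in_linf z /\ forall e : R, 0 < e -> finite_set [set g | e < `|z g|].

(* the sup norm ||z|| = sup_g ||z g|| (meaningful on in_linf) *)
Definition sup_norm (z : fam) : R := sup [set `|z g| | g in [set: G]].

(* Mazur--Ulam property for the Banach space (Z, sup_norm), where
   Z = [set z | P z] is a linear subspace of fam (P = in_linf or in_c0).
   A map Delta : S_Z -> S_Y is represented by a total function fam -> Y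
   whose values are only constrained on S_Z. *)
Definition MazurUlam_property (P : fam -> Prop) : Prop :=
  forall (Y : completeNormedModType R) (Delta : fam -> Y),
    (forall z, P z -> sup_norm z = 1 -> `|Delta z| = 1) ->
    (forall z w, P z -> P w -> sup_norm z = 1 -> sup_norm w = 1 ->
        `|Delta z - Delta w| = sup_norm (fam_sub z w)) ->
    (forall y : Y, `|y| = 1 -> exists z, P z /\ sup_norm z = 1 /\ Delta z = y) ->
    exists T : fam -> Y,
      (forall (a : R) z w, P z -> P w ->
          T (fam_add (fam_scale a z) w) = a *: T z + T w) /\
      (forall z w, P z -> P w -> `|T z - T w| = sup_norm (fam_sub z w)) /\
      (forall y : Y, exists z, P z /\ T z = y) /\
      (forall z, P z -> sup_norm z = 1 -> T z = Delta z).

End Sums.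
End Defs.
Arguments MazurUlam_property {R G} X P.
Arguments in_c0 {R G} X z.
Arguments in_linf {R G} X z.

(* Main.v *)
Require Import Defs.
From HB Require Import structures.
From mathcomp Require Import all_boot all_order all_algebra.
From mathcomp Require Import all_classical all_reals all_analysis.
From mathcomp Require Import lra ring.
Set Implicit Arguments. Unset Strict Implicit. Unset Printing Implicit Defensive.
Import Order.TTheory GRing.Theory Num.Theory.
Import numFieldNormedType.Exports.
Local Open Scope classical_set_scope.
Local Open Scope ring_scope.

(** For a unit vector [x] of [X g], the face [{z : z g = x}] of the ball of [Z] is
    the star of a point, i.e. the set of [z] in the sphere at distance [2] from
    the family with only coordinate [- x].  Hence its image under [Delta] is a
    star in [Y], and comparing stars along a midpoint shows that this image is
    convex.  By Hahn-Banach some norm-one functional [psi] on [Y] equals [1] on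
    it.  The point is that for a smooth [x] with support functional [f],
    [psi (Delta z) = f (z g)] for all [z] in the sphere: if [z] attains its norm
    at a coordinate [h <> g], convexity of the image of the face at [h] together
    with strict convexity of [X g] yields points whose [g]-th coordinate divides
    the segment from [z g] to [x] (or [- x]) in a given ratio and at which [psi]
    is interpolated in that ratio; the bounds
    [1 - |x - z g| <= psi (Delta z) <= |x + z g| - 1] near [x] then identify
    the value, by smoothness.  The functionals [f (z g)] separate points, so the
    positively homogeneous extension of [Delta] is linear. *)

(** * Hahn-Banach through maximal convex cones below the norm *)

Section HahnBanach.
Variables (R : realType) (V : normedModType R).
Implicit Types (S M : set (V * R)) (v : V).

(** A pair [(v, c)] records the constraint [c <= psi v] on a functional [psi] still to be found; the
    closure rules are the consequences of linearity for such constraints. *)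
Definition dominated_cone S : Prop :=
  [/\ forall v c, S (v, c) -> c <= `|v|,
      forall v c w d, S (v, c) -> S (w, d) -> S (v + w, c + d) &
      forall v c t, 0 <= t -> S (v, c) -> S (t *: v, t * c)].

(** Zorn's lemma is applied to the sets [M] for which [S] joined with [M] is a dominated cone, so
    that the empty chain has the bound [S] itself. *)
Lemma maximal_dominated_cone S : dominated_cone S ->
  exists M, [/\ dominated_cone M, S `<=` M &
    forall M', dominated_cone M' -> M `<=` M' -> M' `<=` M].
Proof.
move=> hS.
have [F hF tF|M [hM maxM]] := @Zorn_bigcup _ (fun M => dominated_cone (S `|` M)).
  (* In a chain, two points of the union already lie in one member, so each cone axiom is checked
     inside a single cone. *)
  have common p q : (S `|` \bigcup_(X in F) X) p ->
      (S `|` \bigcup_(X in F) X) q ->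
      exists X, [/\ dominated_cone (S `|` X), (S `|` X) p, (S `|` X) q &
        S `|` X `<=` S `|` \bigcup_(X in F) X].
    have FX X : F X -> S `|` X `<=` S `|` \bigcup_(X in F) X.
      by move=> FX; apply: setUS; apply: bigcup_sup.
    move=> [Sp|[X FX1 Xp]] [Sq|[Y FY1 Yq]].
    - by exists set0; rewrite setU0; split.
    - by exists Y; split; [exact: hF|left|right|exact: FX].
    - by exists X; split; [exact: hF|right|left|exact: FX].
    - have [XY|YX] := tF _ _ FX1 FY1.
      + by exists Y; split; [exact: hF|right; exact: XY|right|exact: FX].
      + by exists X; split; [exact: hF|right|right; exact: YX|exact: FX].
  split.
  - by move=> v c h; have [X [[+ _ _] Xp _ _]] := common _ _ h h; apply.
  - move=> v c w d h1 h2; have [X [[_ + _] Xp Xq sX]] := common _ _ h1 h2.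
    by move=> /(_ _ _ _ _ Xp Xq)/sX.
  - move=> v c t t0 h; have [X [[_ _ +] Xp _ sX]] := common _ _ h h.
    by move=> /(_ _ _ _ t0 Xp)/sX.
exists (S `|` M); split => //.
move=> M' hM' sM p M'p; right; apply: contrapT => nMp.
apply: (maxM M').
  split; first by move=> q Mq; apply: sM; right.
  by move=> /(_ _ M'p).
by rewrite setUidr // => q Sq; apply: sM; left.
Qed.

(** Maximality yields, for every [v], some [c] with both [(v, c)] and [(- v, - c)] in the cone;
    domination at [0] makes this [c] unique and additive in [v]. *)
Lemma dominated_functional S : dominated_cone S -> S (0, 0) ->
  exists psi : V -> R, [/\ linear_functional psi, forall v, `|psi v| <= `|v| &
    forall v c, S (v, c) -> c <= psi v].
Proof.
move=> hS S0; have [M [[Mle MD MZ] sM maxM]] := maximal_dominated_cone hS.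
have M0 : M (0, 0) by exact: sM.
(* Adjoining the ray through [(v, c)] keeps the cone dominated: rescaling by [t^-1] reduces to the
   case [t = 1], which is the assumption. *)
have extend v c : (forall w d, M (w, d) -> d + c <= `|w + v|) -> M (v, c).
  move=> vc; pose M' : set (V * R) :=
    [set p | exists q t, [/\ M q, 0 <= t & p = (q.1 + t *: v, q.2 + t * c)]].
  apply: (maxM M'); last first.
  - by exists (0, 0), 1; split => //=; rewrite !add0r scale1r mul1r.
  - by move=> [w d] Mwd; exists (w, d), 0; split => //=; rewrite scale0r mul0r !addr0.
  split.
  - move=> _ _ [[w d] [t [Mwd t0 [-> ->]]]] /=.
    have [->|tn0] := eqVneq t 0; first by rewrite scale0r mul0r !addr0; exact: Mle.
    have tp : 0 < t by rewrite lt_neqAle eq_sym tn0.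
    have := vc _ _ (MZ _ _ t^-1 _ Mwd); rewrite invr_ge0 => /(_ t0).
    rewrite -(ler_pM2l tp) mulrDr mulrA divff // mul1r => /le_trans; apply.
    by rewrite -{1}(gtr0_norm tp) -normrZ scalerDr scalerA divff // scale1r.
  - move=> _ _ _ _ [[w d] [t [Mwd t0 [-> ->]]]] [[w' d'] [t' [Mwd' t0' [-> ->]]]] /=.
    exists (w + w', d + d'), (t + t'); split; [exact: MD|exact: addr_ge0|].
    by rewrite /= scalerDl mulrDl; congr (_, _); rewrite addrACA.
  - move=> _ _ s s0 [[w d] [t [Mwd t0 [-> ->]]]] /=.
    exists (s *: w, s * d), (s * t); split; [exact: MZ|exact: mulr_ge0|].
    by rewrite /= scalerDr scalerA mulrDr mulrA.
(* The classical gap: every [d - |w - v|] lies below every [|w' + v| - d'], and [c] is the infimum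
   of the latter. *)
have both v : exists c, M (v, c) /\ M (- v, - c).
  pose B := [set `|w.1 + v| - w.2 | w in M].
  have lbB w d : M (w, d) -> lbound B (d - `|w - v|).
    move=> Mwd _ [[w' d'] Mwd' <-] /=.
    have := Mle _ _ (MD _ _ _ _ Mwd Mwd').
    have : `|w + w'| <= `|w - v| + `|w' + v|.
      by apply: le_trans (ler_normD _ _); rewrite addrACA addNr addr0.
    lra.
  have B0 : B !=set0 by exists (`|0 + v| - 0); exists (0, 0).
  have hB : has_lbound B by exists (0 - `|0 - v|); exact: lbB.
  exists (inf B); split; apply: extend => w d Mwd.
    have : inf B <= `|w + v| - d by apply: ge_inf => //; exists (w, d).
    lra.
  have : d - `|w - v| <= inf B by apply: lb_le_inf => //; exact: lbB.
  lra.
have [psi hpsi] := choice both.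
have psi_ge v c : M (v, c) -> c <= psi v.
  move=> Mvc; have [_ h] := hpsi v.
  have := Mle _ _ (MD _ _ _ _ Mvc h); rewrite subrr normr0; lra.
have psiN v : psi (- v) = - psi v.
  have [h1 /psi_ge h2] := hpsi v; have [h3 _] := hpsi (- v).
  have := Mle _ _ (MD _ _ _ _ h1 h3); rewrite subrr normr0 => h.
  by apply/eqP; rewrite eq_le h2 andbT; lra.
have psiD v w : psi (v + w) = psi v + psi w.
  have [h1 h2] := hpsi v; have [h3 h4] := hpsi w.
  have := psi_ge _ _ (MD _ _ _ _ h1 h3).
  have := psi_ge _ _ (MD _ _ _ _ h2 h4).
  rewrite -(opprD v) psiN => a b; apply/eqP; rewrite eq_le b andbT; lra.
have psiZp t v : 0 <= t -> psi (t *: v) = t * psi v.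
  move=> t0; have [h1 h2] := hpsi v.
  have := psi_ge _ _ (MZ _ _ _ t0 h1).
  have := psi_ge _ _ (MZ _ _ _ t0 h2).
  rewrite scalerN psiN => a b; apply/eqP; rewrite eq_le b andbT; lra.
exists psi; split; last by move=> v c /sM/psi_ge.
- move=> a u v; rewrite psiD; congr (_ + _).
  have [a0|a0] := leP 0 a; first exact: psiZp.
  by rewrite -[a]opprK scaleNr psiN psiZp ?mulNr // oppr_ge0 ltW.
- move=> v; have [/Mle h1 /Mle] := hpsi v; rewrite normrN => h2.
by rewrite ler_norml h1 andbT lerNl.
Qed.

End HahnBanach.

(** * Support functionals, smooth points and strict convexity *)

Section Functionals.
Variables (R : realType) (V : normedModType R).
Implicit Types (f : V -> R) (u v x : V) (a c s t : R).

Lemma functionalD f u v : linear_functional f -> f (u + v) = f u + f v.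
Proof. by move=> h; rewrite -[u in LHS]scale1r h mul1r. Qed.

Lemma functional0 f : linear_functional f -> f 0 = 0.
Proof. by move=> /(_ (-1) 0 0); rewrite scaleN1r oppr0 addr0 mulN1r addNr. Qed.

Lemma functionalZ f a u : linear_functional f -> f (a *: u) = a * f u.
Proof. by move=> h; rewrite -[_ *: _]addr0 h functional0 // addr0. Qed.

Lemma functionalN f u : linear_functional f -> f (- u) = - f u.
Proof. by move=> h; rewrite -scaleN1r functionalZ // mulN1r. Qed.

Lemma functionalB f u v : linear_functional f -> f (u - v) = f u - f v.
Proof. by move=> h; rewrite functionalD // functionalN. Qed.

(** The cone of all [(t *: d, t)] is dominated because [D] lies in the unit sphere, and closed under
    sums because [D] is convex. *)
Lemma supporting_functional (D : set V) :
  D !=set0 -> (forall d, D d -> `|d| = 1) ->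
  (forall d e s, D d -> D e -> 0 <= s <= 1 -> D (s *: d + (1 - s) *: e)) ->
  exists psi : V -> R, [/\ linear_functional psi, forall v, `|psi v| <= `|v| &
    forall d, D d -> psi d = 1].
Proof.
move=> [d0 Dd0] D1 Dconv.
have [||psi [lpsi npsi hpsi]] := @dominated_functional R V
    [set p | exists t d, [/\ 0 <= t, D d & p = (t *: d, t)]].
- split.
  + by move=> _ _ [t [d [t0 Dd [-> ->]]]]; rewrite normrZ D1 // mulr1 ger0_norm.
  + move=> _ _ _ _ [t [d [t0 Dd [-> ->]]]] [s [e [s0 De [-> ->]]]].
    have [ts0|tsn0] := eqVneq (t + s) 0.
      have -> : t = 0 by lra.
      have -> : s = 0 by lra.
      by exists 0, d; rewrite !scale0r !addr0.
    have tsp : 0 < t + s by rewrite lt_neqAle eq_sym tsn0 addr_ge0.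
    exists (t + s), (t / (t + s) *: d + (1 - t / (t + s)) *: e); split.
    * exact: addr_ge0.
    * apply: Dconv => //; rewrite divr_ge0 ?(ltW tsp) //=.
      by rewrite ler_pdivrMr // mul1r lerDl.
    * rewrite scalerDr !scalerA; congr (_ *: _ + _ *: _, _); field; exact: lt0r_neq0.
  + move=> _ _ s s0 [t [d [t0 Dd [-> ->]]]]; exists (s * t), d.
    by rewrite scalerA mulr_ge0.
- by exists 0, d0; rewrite scale0r.
exists psi; split => // d Dd; apply/eqP; rewrite eq_le; apply/andP; split.
  by rewrite -(D1 _ Dd); apply: le_trans (npsi _); exact: ler_norm.
by apply: hpsi; exists 1, d; rewrite scale1r.
Qed.

(** The bounds say that the norm grows at [x] in direction [v] with slope at least [c]. Hence the
    cone spanned by [(x, 1)] and [(v, c)] is dominated, and the resulting support functional at [x]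
    must be [f]. *)
Lemma smooth_slope x v c f :
  smooth_point x -> dual_sphere f -> f x = 1 ->
  (forall s, 0 < s < 1 -> 2 - s + s * c <= `|(2 - s) *: x + s *: v|) ->
  c <= f v.
Proof.
move=> [x1 [_ uniq]] df fx h; rewrite /unit_sphere /= in x1.
(* [x + r v] is a convex combination of [x] and [x + t v], with [s = 2 r / (1 + r)]. *)
have slope t : 0 <= t -> 1 + t * c <= `|x + t *: v|.
  move=> t0; pose q := (1 + t)^-1 / 2; pose r := t * q.
  have [->|tn0] := eqVneq t 0; first by rewrite scale0r mul0r !addr0 x1.
  have tp : 0 < t by rewrite lt_neqAle eq_sym tn0.
  have qE : q * (2 * (1 + t)) = 1 by rewrite /q; field; lra.
  have q0 : 0 < q by rewrite /q divr_gt0 ?invr_gt0 //; lra.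
  have r0 : 0 < r by rewrite mulr_gt0.
  have r1 : r < 1 by rewrite /r; nra.
  have q1 : q <= 1 by nra.
  pose s := 2 * r / (1 + r).
  have sE : s * (1 + r) = 2 * r by rewrite /s; field; rewrite gt_eqF //; lra.
  have s0 : 0 < s by rewrite /s divr_gt0 //; lra.
  have s1 : s < 1 by nra.
  have h2 : 1 + r * c <= `|x + r *: v|.
    have := h s; rewrite s0 s1 => /(_ isT).
    have -> : (2 - s) *: x + s *: v = (2 - s) *: (x + r *: v).
      by rewrite scalerDr scalerA; congr (_ + _ *: _); lra.
    rewrite normrZ gtr0_norm; last lra.
    have -> : 2 - s + s * c = (2 - s) * (1 + r * c) by have := congr1 ( *%R c) sE; lra.
    by rewrite ler_pM2l //; lra.
  have : `|x + r *: v| <= (1 - q) + q * `|x + t *: v|.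
    have -> : x + r *: v = (1 - q) *: x + q *: (x + t *: v).
      by rewrite scalerDr scalerA addrA -scalerDl subrK scale1r /r mulrC.
    apply: le_trans (ler_normD _ _) _; rewrite (normrZ (1 - q)) (normrZ q) x1 mulr1.
    by rewrite (gtr0_norm q0) ger0_norm ?subr_ge0.
  rewrite /r in h2 *; nra.
(* The boundary ray of the cone, with no [x] component, where rescaling by [s^-1] is impossible. *)
have slope0 t : 0 <= t -> t * c <= t * `|v|.
  move=> t0; have := slope t t0; have := ler_normD x (t *: v).
  rewrite x1 normrZ ger0_norm //; lra.
have [||psi [lpsi npsi hpsi]] := @dominated_functional R V
    [set p | exists s t, [/\ 0 <= s, 0 <= t & p = (s *: x + t *: v, s + t * c)]].
- split.
  + move=> _ _ [s [t [s0 t0 [-> ->]]]].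
    have [->|sn0] := eqVneq s 0.
      by rewrite scale0r !add0r normrZ ger0_norm // slope0.
    have sp : 0 < s by rewrite lt_neqAle eq_sym sn0.
    have -> : s *: x + t *: v = s *: (x + (t / s) *: v).
      by rewrite scalerDr scalerA mulrC divfK.
    have -> : s + t * c = s * (1 + t / s * c) by field.
    by rewrite normrZ gtr0_norm // ler_pM2l // slope ?divr_ge0.
  + move=> _ _ _ _ [s [t [s0 t0 [-> ->]]]] [s' [t' [s0' t0' [-> ->]]]].
    exists (s + s'), (t + t'); rewrite !addr_ge0 //; split => //.
    by rewrite !scalerDl mulrDl; congr (_, _); rewrite addrACA.
  + move=> _ _ r r0 [s [t [s0 t0 [-> ->]]]].
    exists (r * s), (r * t); rewrite !mulr_ge0 //; split => //.
    by rewrite scalerDr !scalerA mulrDr mulrA.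
- by exists 0, 0; rewrite !scale0r mul0r !addr0.
have psix : psi x = 1.
  apply/eqP; rewrite eq_le; apply/andP; split.
    by rewrite -x1; apply: le_trans (npsi _); exact: ler_norm.
  by apply: hpsi; exists 1, 0; rewrite scale1r scale0r mul0r !addr0.
have dpsi : dual_sphere psi.
  split => //; split => // e e0; exists x; rewrite psix x1 normr1 lexx; split => //.
  lra.
rewrite (uniq _ _ df fx dpsi psix); apply: hpsi; exists 0, 1.
by rewrite scale0r scale1r !add0r mul1r.
Qed.

(** The midpoint of [x] and [v] is a unit vector, hence extreme. *)
Lemma strictly_convex_eq x v :
  strictly_convex V -> `|x| = 1 -> `|v| <= 1 -> `|x + v| = 2 -> v = x.
Proof.
move=> sc x1 v1 xv.
have m1 : unit_sphere (2^-1 *: (x + v)).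
  by rewrite /unit_sphere /= normrZ xv ger0_norm // mulVf.
have [_ /(_ x v 2^-1)] := sc _ m1.
rewrite /unit_ball /= x1 lexx v1 => /(_ isT isT); case.
- by apply/andP; split; lra.
- by rewrite scalerDr; congr (_ + _ *: _); lra.
- by move=> {2}-> <-.
Qed.

(** The unit vector along [a - b] is the combination, with weights [s] and [1 - s], of [u - b] and
    [a - u] rescaled into the unit ball; extremality identifies all three. *)
Lemma strictly_convex_between (a b u : V) (s : R) : strictly_convex V -> 0 < s < 1 ->
  `|u - a| <= (1 - s) * `|a - b| -> `|u - b| <= s * `|a - b| ->
  u = s *: a + (1 - s) *: b.
Proof.
move=> sc /andP[s0 s1] ha hb; pose r := `|a - b|.
have [ab|ab] := eqVneq a b.
  move: ha; rewrite ab subrr normr0 mulr0 normr_le0 subr_eq0 => /eqP ->.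
  by rewrite -scalerDl addrC subrK scale1r.
have r0 : 0 < r by rewrite normr_gt0 subr_eq0.
have r1 : 0 < (1 - s) * r by rewrite mulr_gt0 // subr_gt0.
have r2 : 0 < s * r by rewrite mulr_gt0.
pose p := ((1 - s) * r)^-1 *: (a - u); pose q := (s * r)^-1 *: (u - b).
have m1 : unit_sphere (r^-1 *: (a - b)).
  by rewrite /unit_sphere /= normrZ gtr0_norm ?invr_gt0 // mulVf ?gt_eqF.
have [_ /(_ q p s)] := sc _ m1; case.
- rewrite /unit_ball /= normrZ gtr0_norm ?invr_gt0 //.
  by rewrite ler_pdivrMl // mulr1.
- rewrite /unit_ball /= normrZ gtr0_norm ?invr_gt0 // distrC.
  by rewrite ler_pdivrMl // mulr1.
- by rewrite s0.
- have -> : a - b = (u - b) + (a - u) by rewrite [RHS]addrC subrKA.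
  rewrite scalerDr !scalerA; congr (_ *: _ + _ *: _); field.
    by rewrite !gt_eqF.
  by rewrite subr_eq0 !gt_eqF.
move=> /(congr1 (fun v => (s * r) *: v)); rewrite !scalerA.
rewrite divff ?gt_eqF // scale1r mulfK ?gt_eqF // => + _.
move=> /(canRL (subrK _)) ->.
by rewrite scalerBr scalerBl scale1r -addrA (addrC b) addrA addrAC.
Qed.

End Functionals.

(** * Separation of points by support functionals at smooth points *)

Section SmoothSeparation.
Variables (R : realType) (V : normedModType R).

Lemma normr_double (v : V) : `|v + v| = 2 * `|v|.
Proof. by rewrite -mulr2n normrMn mulr_natl. Qed.

(** If [v] were nonzero, a smooth [x] at distance less than [1] from the direction of [v] would give
    a functional [f] of norm one with [f x = 1] that vanishes on that direction. *)
Lemma smooth_functionals_separate (v : V) : smooth_dense_in_sphere V ->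
  (forall x f, smooth_point x -> dual_sphere f -> f x = 1 -> f v = 0) -> v = 0.
Proof.
move=> dense h; apply/eqP/negPn/negP => vn0.
have vp : 0 < `|v| by rewrite normr_gt0.
have v1 : unit_sphere (`|v|^-1 *: v).
  by rewrite /unit_sphere /= normrZ gtr0_norm ?invr_gt0 // mulVf ?gt_eqF.
have [x [sx xv]] := dense _ v1 1 ltr01.
have [_ [[f [df fx]] _]] := sx; have [lf [nf _]] := df.
have := nf (`|v|^-1 *: v - x); have := ler_norm (- f (`|v|^-1 *: v - x)).
rewrite normrN functionalB // functionalZ // (h x f) // mulr0 fx; lra.
Qed.

End SmoothSeparation.

(** * Families, the sup norm and the two subspaces *)

Section Families.
Variables (R : realType) (G : Type) (X : G -> completeNormedModType R).
Implicit Types (z w : fam X) (g h : G).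

(** [G] is a bare type, so indices are compared classically, and [v] is transported along the
    equality because the fibres depend on the index. *)
Definition update z g (v : X g) : fam X := fun h =>
  match pselect (g = h) with
  | left e => eq_rect g (fun k => X k : Type) v h e
  | right _ => z h
  end.

Lemma update_same z g (v : X g) : update z v g = v.
Proof.
rewrite /update; case: pselect => // e.
by rewrite (Prop_irrelevance e erefl).
Qed.

Lemma update_other z g (v : X g) h : g <> h -> update z v h = z h.
Proof. by rewrite /update; case: pselect. Qed.

Lemma ler_sup_norm z g : in_linf X z -> `|z g| <= sup_norm z.
Proof.
by move=> [M hM]; apply: ub_le_sup; [exists M => _ [h _ <-]|exists g].
Qed.

Lemma sup_norm_le z (M : R) (g0 : G) :
  (forall g, `|z g| <= M) -> sup_norm z <= M.
Proof.
by move=> hM; apply: ge_sup; [exists `|z g0|, g0|move=> _ [h _ <-]].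
Qed.

Lemma sup_normZ a z (g0 : G) : in_linf X z ->
  sup_norm (fam_scale a z) = `|a| * sup_norm z.
Proof.
move=> bz.
(* The reverse inequality comes from the same bound for the inverse scalar. *)
have le_scale b w : in_linf X w -> sup_norm (fam_scale b w) <= `|b| * sup_norm w.
  move=> bw; apply: (sup_norm_le g0) => g.
  by rewrite /fam_scale normrZ ler_wpM2l // ler_sup_norm.
apply/eqP; rewrite eq_le le_scale //=.
have [->|a0] := eqVneq a 0.
  rewrite normr0 mul0r.
  apply: le_trans (normr_ge0 _) (ler_sup_norm g0 _).
  by exists 0 => g; rewrite /fam_scale scale0r normr0.
have {1}-> : z = fam_scale a^-1 (fam_scale a z).
  by apply: functional_extensionality_dep => g; rewrite /fam_scale scalerA mulVf // scale1r.
rewrite -ler_pdivlMl ?normr_gt0 // -normfV; apply: le_scale.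
have [M hM] := bz; exists (`|a| * M) => g.
by rewrite /fam_scale normrZ ler_wpM2l // hM.
Qed.

(** What the argument uses about the domain; it lets one proof serve both sums. *)
Definition stable_subspace (P : fam X -> Prop) : Prop :=
  [/\ forall z, P z -> in_linf X z, P (fun=> 0),
      forall a z w, P z -> P w -> P (fam_add (fam_scale a z) w) &
      forall z g (v : X g), P z -> P (update z v)].

Lemma in_linf_stable : stable_subspace (in_linf X).
Proof.
split => //.
- by exists 0 => g; rewrite normr0.
- move=> a z w [M hM] [M' hM']; exists (`|a| * M + M') => g.
  rewrite /fam_add /fam_scale; apply: le_trans (ler_normD _ _) _.
  by rewrite normrZ lerD ?hM' // ler_wpM2l // hM.
- move=> z g v [M hM]; exists (Num.max M `|v|) => h.
  have [e|ne] := pselect (g = h).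
    by case: _ / e; rewrite update_same le_max lexx orbT.
  by rewrite update_other // le_max hM.
Qed.

Lemma in_c0_stable : stable_subspace (in_c0 X).
Proof.
have [_ l0 lD lU] := in_linf_stable; split => [z []//||a z w [bz fz] [bw fw]|z g v [bz fz]].
- split => // e e0; rewrite (_ : mkset _ = set0) //.
  by apply/seteqP; split => // g /=; rewrite normr0; lra.
- split; first exact: lD.
  (* Adding [1] keeps the divisor positive when [a] is zero. *)
  move=> e e0; pose b := `|a| + 1.
  have b0 : 0 < b by rewrite ltr_wpDl.
  apply: sub_finite_set (_ : _ `<=` [set g | e / 2 / b < `|z g|] `|` [set g | e / 2 < `|w g|]) _.
    move=> g /= eg; have [hw|hw] := ltP (e / 2) `|w g|; [by right|left].
    rewrite ltr_pdivrMr //; apply: contrapT => /negP; rewrite -leNgt => hz.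
    have := ler_normD (a *: z g) (w g); rewrite normrZ.
    rewrite /fam_add /fam_scale in eg; have := normr_ge0 (z g).
    rewrite /b in hz; nra.
  rewrite finite_setU; split; [apply: fz|apply: fw]; rewrite ?divr_gt0 //.
- split; first exact: lU.
  move=> e e0; apply: sub_finite_set (_ : _ `<=` [set g | e < `|z g|] `|` [set g]) _.
    move=> h /= eh; have [->|ne] := pselect (g = h); [by right|left].
    by rewrite update_other in eh.
  by rewrite finite_setU; split; [exact: fz|exact: finite_set1].
Qed.

End Families.

(** * The sphere of the sum and coordinatewise estimates for the isometry *)

Section Extension.
Variables (R : realType) (G : Type) (X : G -> completeNormedModType R).
Hypothesis other : forall g : G, exists h, g <> h.
Hypothesis hsc : forall g, strictly_convex (X g).
Hypothesis unit_exists : forall g, exists v : X g, `|v| = 1.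
Hypothesis hsm : forall g, smooth_dense_in_sphere (X g).
Variable g0 : G.
Variable P : fam X -> Prop.
Hypothesis stP : stable_subspace P.
Variables (Y : completeNormedModType R) (Delta : fam X -> Y).

Definition sphere (z : fam X) := P z /\ sup_norm z = 1.

Hypothesis Delta_norm : forall z, sphere z -> `|Delta z| = 1.
Hypothesis Delta_iso : forall z w, sphere z -> sphere w ->
  `|Delta z - Delta w| = sup_norm (fam_sub z w).
Hypothesis Delta_surj : forall y, `|y| = 1 -> exists z, sphere z /\ Delta z = y.

Implicit Types (z w u : fam X) (g h : G).

Lemma sphere_le z g : sphere z -> `|z g| <= 1.
Proof. by have [lP _ _ _] := stP; move=> [/lP Pz <-]; exact: ler_sup_norm. Qed.

Lemma sphere_intro z g : P z -> (forall h, `|z h| <= 1) -> `|z g| = 1 -> sphere z.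
Proof.
have [lP _ _ _] := stP.
move=> Pz z1 zg; split => //; apply/eqP; rewrite eq_le (sup_norm_le g0) //=.
by rewrite -zg ler_sup_norm //; exact: lP.
Qed.

Lemma update_le1 z g (v : X g) : sphere z -> `|v| = 1 -> forall h, `|update z v h| <= 1.
Proof.
move=> sz v1 h; have [e|ne] := pselect (g = h).
  by case: _ / e; rewrite update_same v1.
by rewrite update_other // sphere_le.
Qed.

Lemma sphere_update z g (v : X g) : sphere z -> `|v| = 1 -> sphere (update z v).
Proof.
have [_ _ _ uP] := stP; move=> sz v1; apply: (@sphere_intro _ g).
- by apply: uP; case: sz.
- exact: update_le1.
- by rewrite update_same.
Qed.

Definition single g (v : X g) : fam X := update (fun=> 0) v.

Lemma sphere_single g (v : X g) : `|v| = 1 -> sphere (single v).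
Proof.
have [_ P0 _ uP] := stP; move=> v1; apply: (@sphere_intro _ g).
- exact: uP.
- move=> h; have [e|ne] := pselect (g = h).
    by case: _ / e; rewrite /single update_same v1.
  by rewrite /single update_other // normr0.
- by rewrite /single update_same.
Qed.

Lemma stableZ a z : P z -> P (fam_scale a z).
Proof.
have [_ P0 aP _] := stP; move=> /aP/(_ P0); move=> /(_ a).
congr (P _); apply: functional_extensionality_dep => g.
by rewrite /fam_add addr0.
Qed.

Lemma sphereN z : sphere z -> sphere (fam_scale (-1) z).
Proof.
have [lP _ _ _] := stP; move=> [Pz z1]; split; first exact: stableZ.
by rewrite sup_normZ ?z1 ?normrN1 ?mulr1 //; exact: lP.
Qed.

Lemma Delta_ge z w g : sphere z -> sphere w -> `|z g - w g| <= `|Delta z - Delta w|.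
Proof.
move=> sz sw; rewrite Delta_iso //; apply: (@ler_sup_norm _ _ _ (fam_sub z w)).
exists 2 => h; rewrite /fam_sub; apply: le_trans (ler_normB _ _) _.
have := sphere_le h sz; have := sphere_le h sw; lra.
Qed.

Lemma Delta_le z w (M : R) : sphere z -> sphere w ->
  (forall g, `|z g - w g| <= M) -> `|Delta z - Delta w| <= M.
Proof. by move=> sz sw h; rewrite Delta_iso //; exact: sup_norm_le. Qed.

Lemma Delta_update z g (v : X g) : sphere z -> sphere (update z v) ->
  `|Delta (update z v) - Delta z| <= `|v - z g|.
Proof.
move=> sz su; apply: Delta_le => // h; have [e|ne] := pselect (g = h).
  by case: _ / e; rewrite update_same.
by rewrite update_other // subrr normr0.
Qed.

(** * Images of faces as stars, and their convexity *)

Definition face g (x : X g) : set Y :=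
  [set y | exists z, [/\ sphere z, z g = x & Delta z = y]].

(** The minus sign stands outside as well, since [Delta] is not known to be odd: distances from
    [Delta (single (- x))] become norms of sums with this point. *)
Definition center g (x : X g) : Y := - Delta (single (- x)).

Lemma center_norm g (x : X g) : `|x| = 1 -> `|center x| = 1.
Proof. by move=> x1; rewrite normrN Delta_norm //; apply: sphere_single; rewrite normrN. Qed.

Lemma face_norm g (x : X g) y : face x y -> `|y| = 1.
Proof. by move=> [z [sz _ <-]]; exact: Delta_norm. Qed.

(** Off [g] the difference from [single (- x)] has norm at most [1], so distance [2] must occur at
    [g], where strict convexity applies. *)
Lemma center_star g (x : X g) z : `|x| = 1 -> sphere z ->
  2 <= `|Delta z + center x| <-> z g = x.
Proof.
move=> x1 sz; have sx : sphere (single (- x)) by apply: sphere_single; rewrite normrN.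
rewrite /center; split => [h|zx]; last first.
  by have := Delta_ge g sz sx; rewrite /single update_same zx opprK normr_double x1 mulr1.
have h2 : 2 <= Num.max 1 `|z g + x|.
  apply: le_trans h _; apply: Delta_le => // k.
  have [e|ne] := pselect (g = k).
    by case: _ / e; rewrite /single update_same opprK le_max lexx orbT.
  by rewrite /single update_other // subr0 le_max sphere_le.
have h3 : 2 <= `|z g + x|.
  by move: h2; rewrite le_max => /orP[|//]; lra.
apply: strictly_convex_eq => //; first exact: sphere_le.
apply/eqP; rewrite eq_le addrC h3 andbT; apply: le_trans (ler_normD _ _) _.
have := sphere_le g sz; rewrite x1; lra.
Qed.

(* The midpoint [m] of [center x] and [d] satisfies [St m `<=` St (center x)].
   Pulling [- m] back through [Delta], this inclusion of stars forces equality. *)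
Lemma face_star g (x : X g) d e : `|x| = 1 -> face x d -> face x e ->
  4 <= `|center x + d + (e + e)|.
Proof.
move=> x1 fd [z [sz zx <-]]; set c := center x.
have c1 : `|c| = 1 by exact: center_norm.
have d1 := face_norm fd.
have cd : 2 <= `|c + d|.
  by have [w [sw wx <-]] := fd; rewrite addrC; apply/center_star.
pose m := 2^-1 *: (c + d).
have cdm : c + d = m + m.
  by rewrite /m -scalerDl (_ : 2^-1 + 2^-1 = 1) ?scale1r //; lra.
have m1 : `|m| = 1.
  have := normr_double m; rewrite -cdm => h.
  have := ler_normD c d; lra.
have [v [sv vm]] : exists v, sphere v /\ Delta v = - m.
  by apply: Delta_surj; rewrite normrN.
have star w : sphere w -> 2 <= `|Delta w - Delta v| -> w g = x.
  move=> sw h; apply/center_star => //.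
  have : `|Delta w + m + (Delta w + m)| <= `|Delta w + c| + `|Delta w + d|.
    by rewrite addrACA -cdm addrACA; exact: ler_normD.
  rewrite normr_double; have := ler_normD (Delta w) d.
  rewrite Delta_norm // d1; rewrite vm opprK in h; rewrite -/c; lra.
(* The antipode of [v] is at distance [2] from [v], so [star] applies to it and fixes the coordinate
   of [v] at [g]. *)
have vx : - v g = x.
  have sNv := sphereN sv.
  rewrite -(star _ sNv) ?/fam_scale ?scaleN1r //.
  rewrite Delta_iso // (_ : fam_sub _ _ = fam_scale (- 2) v).
    have [lP _ _ _] := stP; have [Pv v1] := sv.
    by rewrite sup_normZ // ?v1 ?mulr1 ?normrN ?ger0_norm //; exact: lP.
  apply: functional_extensionality_dep => k.
  by rewrite /fam_sub /fam_scale scaleN1r -opprD -mulr2n -scaler_nat scaleNr.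
have : 2 <= `|Delta z + m|.
  have := Delta_ge g sz sv; rewrite vm opprK zx -[v g]opprK vx opprK.
  by rewrite normr_double x1 mulr1.
rewrite cdm addrACA normr_double addrC; lra.
Qed.

(** Splitting the vector of [face_star] as [y + center x] plus a remainder of norm at most [2]
    leaves norm at least [2] for the former, which puts [y] in the star. *)
Lemma face_convex g (x : X g) d e (s : R) : `|x| = 1 -> face x d -> face x e ->
  0 <= s <= 1 -> face x (s *: d + (1 - s) *: e).
Proof.
move=> x1 fd fe /andP[s0 s1]; set y := _ + _.
have c1 := center_norm x1; have d1 := face_norm fd; have e1 := face_norm fe.
have nZ (t : R) (v : Y) : 0 <= t -> `|v| = 1 -> `|t *: v| = t.
  by move=> t0 v1; rewrite normrZ v1 mulr1 ger0_norm.
have yle : `|y| <= 1.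
  apply: le_trans (ler_normD _ _) _.
  rewrite !nZ //; lra.
have yc : 2 <= `|y + center x|.
  have := face_star x1 fd fe.
  have -> : center x + d + (e + e) =
      (y + center x) + ((1 - s) *: d + (1 + s) *: e).
    have {1}-> : d = s *: d + (1 - s) *: d by rewrite -scalerDl addrC subrK scale1r.
    have -> : e + e = (1 - s) *: e + (1 + s) *: e.
      by rewrite -scalerDl -mulr2n -scaler_nat; congr (_ *: _); lra.
    by rewrite [y + _]addrC -!addrA; do 2![congr (_ + _)]; rewrite addrCA.
  have := ler_normD (y + center x) ((1 - s) *: d + (1 + s) *: e).
  have := ler_normD ((1 - s) *: d) ((1 + s) *: e).
  rewrite !nZ //; lra.
have y1 : `|y| = 1.
  have := ler_normD y (center x); lra.
have [z [sz zy]] := Delta_surj y1.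
by exists z; split => //; apply/center_star => //; rewrite zy.
Qed.

(** A partial oddness of [Delta]: the midpoint of [Delta w] and [Delta (single (- x))] stays in the
    face at [- x], so it has norm one, which is the star condition for [- Delta w]. *)
Lemma face_opp g (x : X g) w : `|x| = 1 -> sphere w -> w g = - x ->
  face x (- Delta w).
Proof.
move=> x1 sw wx; have Nx1 : `|- x| = 1 by rewrite normrN.
have sx := sphere_single Nx1.
have fw : face (- x) (Delta w) by exists w.
have fx : face (- x) (Delta (single (- x))).
  by exists (single (- x)); split => //; rewrite /single update_same.
have h01 : 0 <= (2^-1 : R) <= 1 by apply/andP; split; lra.
have := face_norm (face_convex Nx1 fw fx h01).
rewrite (_ : 1 - 2^-1 = 2^-1 :> R); last by lra.
rewrite -scalerDr normrZ ger0_norm ?invr_ge0 // => h.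
have [z [sz zw]] := Delta_surj (etrans (normrN _) (Delta_norm sw)).
exists z; split => //; apply/center_star => //.
by rewrite zw /center -opprD normrN; lra.
Qed.

(** * Functionals supporting the image of a face *)

Definition supports g (x : X g) (psi : Y -> R) : Prop :=
  [/\ linear_functional psi, forall y, `|psi y| <= `|y| &
    forall z, sphere z -> z g = x -> psi (Delta z) = 1].

Lemma supports_exists g (x : X g) : `|x| = 1 -> exists psi, supports x psi.
Proof.
move=> x1; have [|||psi [lpsi npsi hpsi]] := @supporting_functional R Y (face x).
- by exists (Delta (single x)), (single x); split;
    [exact: sphere_single|rewrite /single update_same|].
- by move=> d; exact: face_norm.
- by move=> d e s fd fe; exact: face_convex.
by exists psi; split => // z sz zx; apply: hpsi; exists z.
Qed.

Lemma supports_opp g (x : X g) psi z : `|x| = 1 -> supports x psi ->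
  sphere z -> z g = - x -> psi (Delta z) = - 1.
Proof.
move=> x1 [lpsi npsi hpsi] sz zx; have [w [sw wx wz]] := face_opp x1 sz zx.
by have := hpsi w sw wx; rewrite wz functionalN // => <-; rewrite opprK.
Qed.

(** [psi] is 1-Lipschitz and takes the values [1] and [- 1] once coordinate [g] of [z] is replaced
    by [x] and [- x]. *)
Lemma supports_bounds g (x : X g) psi z : `|x| = 1 -> supports x psi ->
  sphere z -> 1 - `|x - z g| <= psi (Delta z) <= `|x + z g| - 1.
Proof.
move=> x1 hpsi sz; have [lpsi npsi psi1] := hpsi.
have Nx1 : `|- x| = 1 by rewrite normrN.
have sx := sphere_update sz x1; have sNx := sphere_update sz Nx1.
have lip (y y' : Y) : psi y - psi y' <= `|y - y'|.
  by rewrite -functionalB //; apply: le_trans (ler_norm _) (npsi _).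
apply/andP; split.
  have := lip (Delta (update z x)) (Delta z).
  rewrite psi1 ?update_same //; have := Delta_update sz sx; lra.
have := lip (Delta z) (Delta (update z (- x))).
rewrite (supports_opp x1 hpsi sNx) ?update_same //.
by have := Delta_update sz sNx; rewrite -opprD normrN [in X in _ -> X]distrC; lra.
Qed.

(** * Segments in faces and recovery of coordinates *)

Lemma face_segment g (a b : fam X) (s : R) : sphere a -> sphere b ->
  `|a g| = 1 -> b g = a g -> 0 <= s <= 1 ->
  exists u, [/\ sphere u, u g = a g & Delta u = s *: Delta a + (1 - s) *: Delta b].
Proof.
move=> sa sb a1 ba s01; apply: face_convex => //; [by exists a|by exists b].
Qed.

(** Coordinate [g] carries the whole distance between [a] and [b], so the isometry places [u g] at
    distances from [a g] and [b g] that leave only one point. *)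
Lemma segment_coordinate g (a b u : fam X) (s : R) :
  sphere a -> sphere b -> sphere u -> 0 < s < 1 ->
  (forall h, `|a h - b h| <= `|a g - b g|) ->
  Delta u = s *: Delta a + (1 - s) *: Delta b ->
  u g = s *: a g + (1 - s) *: b g.
Proof.
move=> sa sb su s01 ab uE; have /andP[s0 s1] := s01.
have dab := Delta_le sa sb ab.
apply: strictly_convex_between => //.
  apply: le_trans (Delta_ge g su sa) _; rewrite uE.
  have -> : s *: Delta a + (1 - s) *: Delta b - Delta a =
      (1 - s) *: (Delta b - Delta a).
    by rewrite scalerBr [(1 - s) *: Delta a]scalerBl scale1r opprB (addrC (s *: _)) addrA.
  by rewrite normrZ ger0_norm ?subr_ge0 ?(ltW s1) // ler_wpM2l ?subr_ge0 ?(ltW s1) // distrC.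
apply: le_trans (Delta_ge g su sb) _; rewrite uE.
have -> : s *: Delta a + (1 - s) *: Delta b - Delta b = s *: (Delta a - Delta b).
  by rewrite scalerBr scalerBl scale1r -addrA; congr (_ + _); rewrite addrAC subrr add0r.
by rewrite normrZ ger0_norm ?(ltW s0) // ler_wpM2l // ltW.
Qed.

Lemma supports_off_face g h (x : X g) psi f z : g <> h -> smooth_point x ->
  dual_sphere f -> f x = 1 -> supports x psi -> sphere z -> `|z h| = 1 ->
  psi (Delta z) = f (z g).
Proof.
move=> gh sx df fx hpsi sz zh; have x1 : `|x| = 1 by case: sx.
have [lf _] := df; have [lpsi _ psi1] := hpsi.
(* Changing coordinate [g] leaves the norm-one coordinate [h] fixed, so the segment between the two
   images stays in the image of a face. *)
have move_to (x' : X g) (s : R) : `|x'| = 1 -> 0 < s < 1 -> exists u,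
    [/\ sphere u, u g = s *: z g + (1 - s) *: x' &
      psi (Delta u) = s * psi (Delta z) + (1 - s) * psi (Delta (update z x'))].
  move=> x1' s01; have sz' := sphere_update sz x1'.
  have s01' : 0 <= s <= 1 by case/andP: s01 => *; rewrite !ltW.
  have [|u [su uh uE]] := face_segment sz sz' zh _ s01'; first by rewrite update_other.
  exists u; split => //; last by rewrite uE lpsi functionalZ.
  rewrite (@segment_coordinate g _ _ u s sz sz') ?update_same // => k.
  have [e|ne] := pselect (g = k); first by case: _ / e; rewrite update_same.
  by rewrite update_other // subrr normr0.
have Nx1 : `|- x| = 1 by rewrite normrN.
have psix : psi (Delta (update z x)) = 1.
  by apply: psi1; [exact: sphere_update|rewrite update_same].
have psiNx : psi (Delta (update z (- x))) = - 1.
  by apply: (supports_opp x1 hpsi); [exact: sphere_update|rewrite update_same].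
apply/eqP; rewrite eq_le; apply/andP; split.
  apply: (smooth_slope sx df fx) => s s01.
  have [u [su ug psiu]] := move_to x s x1 s01.
  have /andP[_] := supports_bounds x1 hpsi su.
  rewrite psiu psix.
  rewrite ug addrCA -{1}[x]scale1r -scalerDl addrC.
  rewrite (_ : 1 + (1 - s) = 2 - s) ?mulr1; [lra|lra].
(* The reverse inequality is the slope bound in direction [- z g], obtained by moving towards
   [- x]. *)
rewrite -lerN2 -(functionalN _ lf); apply: (smooth_slope sx df fx) => s s01.
have [u [su ug psiu]] := move_to (- x) s Nx1 s01.
have /andP[+ _] := supports_bounds x1 hpsi su.
rewrite psiu psiNx.
rewrite ug opprD scalerN opprK addrCA -{1}[x]scale1r -scalerDl addrC -scalerN.
rewrite (_ : 1 + (1 - s) = 2 - s); [lra|lra].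
Qed.

Lemma unit_chord g (v : X g) : `|v| <= 1 -> exists (a : X g) (s : R),
  [/\ `|a| = 1, 0 <= s <= 1 & v = s *: a + (1 - s) *: - a].
Proof.
move=> v1; suff [a [r [a1 r0 r1 ->]]] : exists (a : X g) (r : R),
    [/\ `|a| = 1, 0 <= r, r <= 1 & v = r *: a].
  (* The weight solves [s - (1 - s) = r]. *)
  exists a, ((1 + r) / 2); split => //; first by apply/andP; split; lra.
  by rewrite scalerN -scaleNr -scalerDl; congr (_ *: _); lra.
have [->|vn0] := eqVneq v 0.
  by have [a a1] := unit_exists g; exists a, 0; rewrite scale0r.
exists (`|v|^-1 *: v), `|v|; rewrite scalerA divff ?normr_eq0 // scale1r; split => //.
by rewrite normrZ normfV normr_id mulVf ?normr_eq0.
Qed.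

(* [Delta] is affine on the face at [g], since [supports_off_face] recovers every
   coordinate other than [g]; a chord in another coordinate [h] then has
   endpoints to which [supports_off_face] applies. *)
Lemma supports_on_face g (x : X g) psi f z : smooth_point x ->
  dual_sphere f -> f x = 1 -> supports x psi -> sphere z -> `|z g| = 1 ->
  psi (Delta z) = f (z g).
Proof.
move=> sx df fx hpsi sz zg; have [h gh] := other g.
have [v [s [v1 s01 zh]]] := unit_chord (sphere_le h sz).
have Nv1 : `|- v| = 1 by rewrite normrN.
have sa := sphere_update sz v1; have sb := sphere_update sz Nv1.
set a := update z v in sa; set b := update z (- v) in sb.
have hg : h <> g by move=> e; apply: gh.
have ag : a g = z g by rewrite /a update_other.
have bg : b g = z g by rewrite /b update_other.
have [||u [su ug uE]] := face_segment (g := g) sa sb _ _ s01; rewrite ?ag ?bg //.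
have zE k : z k = s *: a k + (1 - s) *: b k.
  have [e|ne] := pselect (h = k).
    by case: _ / e; rewrite /a /b !update_same.
  by rewrite /a /b !update_other // -scalerDl addrC subrK scale1r.
have lin (V : normedModType R) (psi' : V -> R) y y' : linear_functional psi' ->
    psi' (s *: y + (1 - s) *: y') = s * psi' y + (1 - s) * psi' y' :> R.
  by move=> l; rewrite l functionalZ.
have uz : u = z.
  apply: functional_extensionality_dep => k.
  have [<-|gk] := pselect (g = k); first by rewrite ug ag.
  have kg : k <> g by move=> e; apply: gk.
  apply/eqP; rewrite -subr_eq0; apply/eqP; apply: smooth_functionals_separate => //.
  move=> x' f' sx' df' fx'; have [psi' hpsi'] := supports_exists (proj1 sx').
  have [lf' _] := df'; have [lpsi' _ _] := hpsi'.
  have off w : sphere w -> w g = z g -> psi' (Delta w) = f' (w k).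
    by move=> sw wg; apply: (supports_off_face kg sx' df' fx' hpsi' sw); rewrite wg.
  have off_u := off _ su (etrans ug ag).
  rewrite functionalB // -off_u uE.
  by rewrite zE (lin _ _ _ _ lpsi') (lin _ _ _ _ lf') !off // ?ag ?bg // subrr.
have [lpsi _ _] := hpsi.
have off w : sphere w -> `|w h| = 1 -> w g = z g -> psi (Delta w) = f (z g).
  by move=> sw wh <-; apply: (supports_off_face gh sx df fx hpsi sw).
rewrite -{1}uz uE (lin _ _ _ _ lpsi) !off //; first by rewrite -mulrDl addrC subrK mul1r.
- by rewrite /b update_same.
- by rewrite /a update_same.
Qed.

(** A point of the sphere may attain its norm nowhere, so a coordinate of norm close to [1] is
    normalized at a cost of at most [e]. *)
Lemma supports_coordinate g (x : X g) psi f z : smooth_point x ->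
  dual_sphere f -> f x = 1 -> supports x psi -> sphere z ->
  psi (Delta z) = f (z g).
Proof.
move=> sx df fx hpsi sz; have zg1 := sphere_le g sz.
have [zg|zgn1] := eqVneq `|z g| 1; first exact: (supports_on_face sx).
have zg : `|z g| < 1 by rewrite lt_neqAle zgn1.
have [lpsi npsi _] := hpsi.
apply/eqP; rewrite -subr_eq0 -normr_le0; apply/ler_addgt0Pr => e e0; rewrite add0r.
(* Exceeding [d] makes [z h] almost of norm one and forces [h] to differ from [g]; the further
   maximum with [0] makes [z h] nonzero. *)
pose d := Num.max (1 - e) `|z g|.
have d1 : d < 1 by rewrite /d gt_max zg andbT; lra.
have [h dh] : exists h, Num.max d 0 < `|z h|.
  apply: contrapT => nh; have [_ z1] := sz.
  have : sup_norm z <= Num.max d 0.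
    apply: (sup_norm_le g0) => h; rewrite leNgt; apply/negP => zh.
    by apply: nh; exists h.
  by rewrite z1 leNgt gt_max d1 ltr01.
move: dh; rewrite !gt_max => /andP[/andP[eh gh'] h0].
have gh : g <> h by move=> e'; move: gh'; case: _ / e'; rewrite ltxx.
pose v := `|z h|^-1 *: z h.
have v1 : `|v| = 1 by rewrite normrZ normfV normr_id mulVf ?gt_eqF.
have sv := sphere_update sz v1.
have vz : `|v - z h| <= e.
  have -> : v - z h = (1 - `|z h|) *: v.
    by rewrite scalerBl scale1r /v scalerA divff ?gt_eqF // scale1r.
  rewrite normrZ v1 mulr1 ger0_norm; first by lra.
  by rewrite subr_ge0 sphere_le.
have <- : update z v g = z g by rewrite update_other // => e'; apply: gh.
rewrite -(supports_off_face gh sx df fx hpsi sv) ?update_same //.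
rewrite -functionalB //; apply: le_trans (npsi _) _.
by rewrite distrC; apply: le_trans (Delta_update sz sv) _.
Qed.

(** * The positively homogeneous extension and its linearity *)

Definition extension z : Y :=
  sup_norm z *: Delta (fam_scale (sup_norm z)^-1 z).

Lemma normalize z : P z -> sup_norm z != 0 -> sphere (fam_scale (sup_norm z)^-1 z).
Proof.
have [lP _ _ _] := stP; move=> Pz z0; split; first exact: stableZ.
have zp : 0 <= sup_norm z.
  by apply: le_trans (normr_ge0 (z g0)) (ler_sup_norm g0 _); exact: lP.
rewrite sup_normZ ?normfV ?ger0_norm ?mulVf //; exact: lP.
Qed.

Lemma sup_norm_eq0 z g : P z -> sup_norm z = 0 -> z g = 0.
Proof.
have [lP _ _ _] := stP; move=> /lP Pz z0.
by apply/eqP; rewrite -normr_le0 -z0 ler_sup_norm.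
Qed.

Lemma extension_coordinate g (x : X g) psi f z : smooth_point x ->
  dual_sphere f -> f x = 1 -> supports x psi -> P z ->
  psi (extension z) = f (z g).
Proof.
move=> sx df fx hpsi Pz; have [lf _] := df; have [lpsi _ _] := hpsi.
(* At norm zero the inverse is a default value, and the outer factor cancels it. *)
rewrite /extension functionalZ //; have [z0|z0] := eqVneq (sup_norm z) 0.
  by rewrite z0 mul0r (sup_norm_eq0 g Pz) // functional0.
rewrite (supports_coordinate sx df fx hpsi (normalize Pz z0)).
by rewrite functionalZ // mulrA divff // mul1r.
Qed.

Lemma extension_norm z : P z -> `|extension z| = sup_norm z.
Proof.
have [lP _ _ _] := stP; move=> Pz; have zp : 0 <= sup_norm z.
  by apply: le_trans (normr_ge0 (z g0)) (ler_sup_norm g0 _); exact: lP.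
rewrite /extension normrZ ger0_norm //; have [z0|z0] := eqVneq (sup_norm z) 0.
  by rewrite z0 mul0r.
by rewrite Delta_norm ?mulr1 //; exact: normalize.
Qed.

Lemma extension_sphere z : sphere z -> extension z = Delta z.
Proof.
move=> [_ z1]; rewrite /extension z1 invr1 scale1r; congr Delta.
by apply: functional_extensionality_dep => g; rewrite /fam_scale scale1r.
Qed.

Lemma extension_surj y : exists z, P z /\ extension z = y.
Proof.
have [lP P0 _ _] := stP; have [->|y0] := eqVneq y 0.
  exists (fun=> 0); split => //; apply/eqP; rewrite -normr_le0 extension_norm //.
  by apply: (sup_norm_le g0) => g; rewrite normr0.
have yp : 0 < `|y| by rewrite normr_gt0.
have [|z [[Pz z1] zy]] := Delta_surj (y := `|y|^-1 *: y).
  by rewrite normrZ normfV normr_id mulVf ?gt_eqF.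
exists (fam_scale `|y| z); split; first exact: stableZ.
rewrite /extension sup_normZ //; last exact: lP.
rewrite z1 normr_id mulr1 (_ : fam_scale _ _ = z).
  by rewrite zy scalerA divff ?gt_eqF // scale1r.
apply: functional_extensionality_dep => g.
by rewrite /fam_scale scalerA mulVf ?gt_eqF // scale1r.
Qed.

(** By surjectivity the defect of linearity is the image of some [u]; the linear [psi] show that
    every smooth support functional kills each coordinate of [u], so the defect has norm zero. *)
Lemma extension_linear a z w : P z -> P w ->
  extension (fam_add (fam_scale a z) w) = a *: extension z + extension w.
Proof.
have [lP P0 aP _] := stP; move=> Pz Pw; apply/eqP; rewrite -subr_eq0; apply/eqP.
have [u [Pu uE]] := extension_surj
  (extension (fam_add (fam_scale a z) w) - (a *: extension z + extension w)).
rewrite -uE; apply/eqP; rewrite -normr_le0 extension_norm //.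
apply: (sup_norm_le g0) => g; rewrite normr_le0; apply/eqP.
apply: smooth_functionals_separate => // x f sx df fx.
have [psi hpsi] := supports_exists (proj1 sx).
have [lf _] := df; have [lpsi _ _] := hpsi.
rewrite -(extension_coordinate sx df fx hpsi Pu) uE functionalB // lpsi.
rewrite !(extension_coordinate sx df fx hpsi) //; last exact: aP.
by rewrite lf subrr.
Qed.

Lemma extension_iso z w : P z -> P w ->
  `|extension z - extension w| = sup_norm (fam_sub z w).
Proof.
have [_ _ aP _] := stP; move=> Pz Pw.
rewrite addrC -scaleN1r -extension_linear // extension_norm; last exact: aP.
congr sup_norm; apply: functional_extensionality_dep => g.
by rewrite /fam_add /fam_scale /fam_sub scaleN1r addrC.
Qed.

End Extension.

(** * Application to the two sums *)

Lemma dim_ge2_unit (R : realType) (V : normedModType R) :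
  dim_ge2 V -> exists v : V, `|v| = 1.
Proof.
move=> [x [y xy]]; have x0 : x != 0.
  apply/eqP => x0; have [] := xy 1 0; first by rewrite x0 scaler0 scale0r addr0.
  by move/eqP; rewrite oner_eq0.
by exists (`|x|^-1 *: x); rewrite normrZ normfV normr_id mulVf ?normr_eq0.
Qed.

Lemma MazurUlam_stable (R : realType) (G : Type) (X : G -> completeNormedModType R)
  (P : fam X -> Prop) :
  (exists g1 g2 : G, g1 <> g2) -> (forall g, strictly_convex (X g)) ->
  (forall g, dim_ge2 (X g)) -> (forall g, smooth_dense_in_sphere (X g)) ->
  stable_subspace P -> MazurUlam_property X P.
Proof.
move=> [g1 [g2 g12]] hsc hdim hsm stP Y Delta hnorm hiso hsurj.
have other (g : G) : exists h, g <> h.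
  have [e|] := pselect (g = g1); last by exists g1.
  by exists g2; rewrite e.
have hunit g := dim_ge2_unit (hdim g).
have hnorm' z : sphere P z -> `|Delta z| = 1 by case; exact: hnorm.
have hiso' z w : sphere P z -> sphere P w ->
    `|Delta z - Delta w| = sup_norm (fam_sub z w).
  by move=> [? ?] [? ?]; exact: hiso.
have hsurj' y : `|y| = 1 -> exists z, sphere P z /\ Delta z = y.
  by move=> /hsurj[z [? [? ?]]]; exists z.
exists (extension Delta); split; last split; last split.
- move=> a z w Pz Pw; apply: (@extension_linear _ _ _ other _ _ _ g1 P) => //.
- move=> z w Pz Pw; apply: (@extension_iso _ _ _ other _ _ _ g1 P) => //.
- by move=> y; apply: (@extension_surj _ _ _ g1 P).
- by move=> z Pz z1; apply: (@extension_sphere _ _ _ P).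
Qed.

Theorem theorem3p3 (R : realType) (G : Type) (X : G -> completeNormedModType R)
  (hG : exists g1 g2 : G, g1 <> g2)
  (hsc : forall g, strictly_convex (X g))
  (hdim : forall g, dim_ge2 (X g))
  (hsm : forall g, smooth_dense_in_sphere (X g)) :
  MazurUlam_property X (in_c0 X) /\ MazurUlam_property X (in_linf X).
Proof.
by split; apply: MazurUlam_stable => //;
  [exact: in_c0_stable|exact: in_linf_stable].
Qed.
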